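(* For every finite graph $G$, $\dim^\circ(G)\le 3\,\mathrm{col}_2(G)$.
   Context: Graphs are finite and simple. A circular-arc graph is the intersection graph of a family of arcs of a circle. The circular dimension $\dim^\circ(G)$ is the minimum $k$ such that $G$ is the intersection (same vertex set, intersection of edge sets) of $k$ circular-arc graphs. For a linear order $\pi$ on $V(G)$ and integer $r\ge 0$, a vertex $u$ is strongly $r$-reachable from $v$ if there is a path $P$ of length at most $r$ between $u$ and $v$ such that $u\le_\pi x$ for all vertices $x$ of $P$ and $v\le_\pi x$ for all vertices $x$ of $P$ other than $u$. The strong $2$-coloring number $\mathrm{col}_2(G)$ is the minimum over linear orders $\pi$ of $V(G)$ of the maximum over vertices $v$ of the number of vertices strongly $2$-reachable from $v$ (including $v$ itself). *)

(* Defs.v *)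
From mathcomp Require Import all_boot all_order all_algebra.
From mathcomp Require Import boolp classical_sets reals set_interval topology normedtype trigo.

Set Implicit Arguments.
Unset Strict Implicit.
Unset Printing Implicit Defensive.

Import Order.TTheory GRing.Theory Num.Theory.

Record sgraph (V : finType) := SGraph {
  adj : rel V;
  adj_sym : symmetric adj;
  adj_irr : irreflexive adj }.

Section Intersection.
Variables (V : finType) (k : nat) (H : 'I_k -> sgraph V).

Definition inter_adj : rel V :=
  [rel u v | (u != v) && [forall i, adj (H i) u v]].

Lemma inter_adj_sym : symmetric inter_adj.
Proof.
move=> u v; rewrite /inter_adj /= eq_sym; congr (_ && _).
by apply: eq_forallb => i; rewrite adj_sym.
Qed.

Lemma inter_adj_irr : irreflexive inter_adj.
Proof. by move=> u; rewrite /inter_adj /= eqxx. Qed.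

(* For k = 0 this is the complete graph on V. *)
Definition inter_graph := SGraph inter_adj_sym inter_adj_irr.

End Intersection.

Section CircularArc.
Variable R : realType.
Local Open Scope ring_scope.
Local Open Scope classical_set_scope.

(* Closed arcs of the unit circle, neither a single point nor the whole circle.
   For finite graphs, also allowing open, one-point or full arcs gives the same
   intersection graphs. *)
Definition is_arc (A : set (R * R)) :=
  exists a b : R, a < b < a + 2 * pi /\
    A = [set (cos t, sin t) | t in `[a, b]].

Definition circular_arc_graph (V : finType) (G : sgraph V) :=
  exists A : V -> set (R * R), (forall v, is_arc (A v)) /\
    forall u v, u != v -> (adj G u v <-> A u `&` A v !=set0).

Definition circ_dim_le (V : finType) (G : sgraph V) (k : nat) :=
  exists H : 'I_k -> sgraph V,
    (forall i, circular_arc_graph (H i)) /\ adj G =2 adj (inter_graph H).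

Section CompleteMinusEdge.
Variables (V : finType) (a b : V).

Definition cme_adj : rel V := [rel u v |
  [&& u != v, (u, v) != (a, b) & (u, v) != (b, a)]].

Lemma cme_sym : symmetric cme_adj.
Proof.
move=> u v; rewrite /cme_adj /= !xpair_eqE (eq_sym v u); congr (_ && _).
by rewrite andbC (andbC (v == b)) (andbC (v == a)).
Qed.

Lemma cme_irr : irreflexive cme_adj.
Proof. by move=> u; rewrite /cme_adj /= eqxx. Qed.

Definition cme_graph := SGraph cme_sym cme_irr.

Lemma cme_circular_arc : a != b -> circular_arc_graph cme_graph.
Proof.
move=> nab; have p0 := pi_gt0 R.
pose arc (x y : R) : set (R * R) := [set (cos t, sin t) | t in `[x, y]].
pose q : R := pi / 4.
have q0 : 0 < q by rewrite divr_gt0.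
have pE : pi = q * 4 :> R by rewrite divfK ?pnatr_eq0.
exists (fun v => if v == a then arc 0 q else
                 if v == b then arc (q * 2) pi else arc 0 pi).
have isarc x y : 0 <= x -> x < y -> y <= pi -> is_arc (arc x y).
  move=> x0 xy yp; exists x, y; split=> //; rewrite xy /=.
  rewrite (le_lt_trans yp)// ltr_wpDl// mulr_natl mulr2n ltrDl//.
have inarc x y t : x <= t <= y -> arc x y (cos t, sin t).
  by move=> xty; exists t => //=; rewrite in_itv.
have q2p : q * 2 < pi by rewrite pE ltr_pM2l// ltr_nat.
have qp : q <= pi by rewrite pE ler_peMr// ?ler1n// ltW.
have q2 : 0 <= q * 2 by rewrite mulr_ge0 ?ltW.
split.
  move=> v; case: ifP => _; first exact: isarc.
  by case: ifP => _; exact: isarc.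
have disj : arc 0 q `&` arc (q * 2) pi !=set0 -> False.
  move=> [z [[t +] + [s + zs]]]; rewrite -{}zs /= !in_itv /=.
  move=> /andP[t0 tq] cst /andP[qs sp]; case: cst => cst _.
  have ts : t = s.
    apply: cos_inj => //; rewrite in_itv /=; apply/andP; split=> //.
      exact: le_trans tq qp.
    exact: le_trans q2 qs.
  have qq : q < q * 2 by rewrite ltr_pMr// ltr1n.
  by move: (lt_le_trans qq qs); rewrite -ts ltNge tq.
have in0 y : 0 <= y -> arc 0 y (cos 0, sin 0).
  by move=> y0; apply: inarc; rewrite lexx.
have inpi x : x <= pi -> arc x pi (cos pi, sin pi).
  by move=> xpi; apply: inarc; rewrite lexx andbT.
have meet0 y y' : 0 <= y -> 0 <= y' -> arc 0 y `&` arc 0 y' !=set0.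
  by move=> ? ?; exists (cos 0, sin 0); split; apply: in0.
have meetpi x x' : x <= pi -> x' <= pi -> arc x pi `&` arc x' pi !=set0.
  by move=> ? ?; exists (cos pi, sin pi); split; apply: inpi.
have [p0' q0' q2p'] := And3 (ltW p0) (ltW q0) (ltW q2p).
have nba : b != a by rewrite eq_sym.
move=> u v nuv; rewrite /= /cme_adj /= nuv /= !xpair_eqE.
have [ua|ua] := eqVneq u a; have [va|va] := eqVneq v a => /=.
- by rewrite ua va eqxx in nuv.
- rewrite ua (negbTE nab) andbT; have [vb|vb] /= := eqVneq v b.
    by split=> // /disj.
  by split=> // _; exact: meet0.
- rewrite andbT; have [ub|ub] /= := eqVneq u b.
    by split=> //; rewrite setIC => /disj.
  by split=> // _; exact: meet0.
- rewrite andbF; split=> // _.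
  by case: ifP => _; case: ifP => _; exact: meetpi.
Qed.

End CompleteMinusEdge.

Section Complete.
Variable V : finType.

Lemma inter0_circular_arc (H : 'I_0 -> sgraph V) :
  circular_arc_graph (inter_graph H).
Proof.
exists (fun=> [set (cos t, sin t) | t in `[0, pi : R]]); split=> [_|u v nuv].
  exists 0, pi; split=> //; rewrite pi_gt0 add0r mulr_natl mulr2n ltrDl.
  exact: pi_gt0.
rewrite /= /inter_adj /= nuv /=; split=> [_|_]; last by apply/forallP; case.
by exists (cos 0, sin 0); split; exists 0 => //=; rewrite in_itv /= lexx pi_ge0.
Qed.

End Complete.

Lemma circ_dim_ex (V : finType) (G : sgraph V) :
  exists k, `[< circ_dim_le G k >].
Proof.
exists #|{: V * V}|; apply/asboolP.
pose K0 : sgraph V := inter_graph (k := 0) (fun i => G).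
exists (fun i => let: (a, b) := enum_val i in
  if (a != b) && ~~ adj G a b then cme_graph a b else K0); split=> [i|u v].
  case: (enum_val i) => a b; case: ifP => [/andP[nab _]|_].
    exact: cme_circular_arc.
  exact: inter0_circular_arc.
rewrite /= /inter_adj /=; have [<-|nuv] /= := eqVneq u v; first by rewrite adj_irr.
apply/idP/forallP => [Guv i|/(_ (enum_rank (u, v)))]; last first.
  by rewrite enum_rankK nuv /=; case: (adj G u v) => //=; rewrite /cme_adj /= eqxx andbF.
case: (enum_val i) => a b; case: ifP => [/andP[_ nG]|_] /=; rewrite /cme_adj /inter_adj /= nuv //=.
  by apply/andP; split; apply: contraNneq nG => -[<- <-] //; rewrite adj_sym.
by apply/forallP; case.
Qed.

Definition circ_dim (V : finType) (G : sgraph V) : nat :=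
  ex_minn (circ_dim_ex G).

End CircularArc.

Section StrongColoring.
Variable V : finType.

Definition linear_order (le : rel V) :=
  [/\ reflexive le, antisymmetric le, transitive le & total le].

(* The path is v :: p, traversed from v to u; its length is size p. *)
Definition strongly_reachable (G : sgraph V) (r : nat) (le : rel V) (v u : V) :=
  exists p : seq V,
    [/\ path (adj G) v p, uniq (v :: p), last v p = u, size p <= r &
        forall x, x \in v :: p -> le u x /\ (x != u -> le v x)].

Definition max_strongly_reachable (G : sgraph V) (r : nat) (le : rel V) : nat :=
  \max_(v : V) #|[pred u | `[< strongly_reachable G r le v u >]]|.

Lemma strong_col_ex (G : sgraph V) (r : nat) :
  exists m, `[< exists2 le : rel V,
    linear_order le & max_strongly_reachable G r le = m >].
Proof.
pose le : rel V := [rel x y | enum_rank x <= enum_rank y].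
exists (max_strongly_reachable G r le); apply/asboolP; exists le => //.
split=> [x|x y|x y z|x y]; rewrite /le /=.
- exact: leqnn.
- by rewrite -eqn_leq => /eqP/val_inj/enum_rank_inj.
- exact: leq_trans.
- exact: leq_total.
Qed.

Definition strong_col (r : nat) (G : sgraph V) : nat :=
  ex_minn (strong_col_ex G r).

End StrongColoring.

(* Main.v *)
(* Fix an order witnessing col_2 and colour greedily, so that no vertex shares
   its colour with another vertex strongly 2-reachable from it.  If u < v are
   two neighbours of x that precede x, then u is strongly 2-reachable from v
   along v x u; hence x has at most one earlier neighbour n(x) in each colour
   class S.  Put S on the circle in increasing order as disjoint short arcs that
   avoid the origin, and represent every x outside S by an arc through the
   origin: in one graph it runs from n(x) to the origin, in the other from x
   through the origin to n(x).  Both graphs contain G, and together they miss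
   every non-edge whose smaller end is in S.  So two circular-arc graphs per
   colour suffice, and the bound holds even with the factor 2. *)

Require Import Defs.
From mathcomp Require Import all_boot reals.
From mathcomp Require Import all_order all_algebra lra zify.
From mathcomp Require Import boolp classical_sets set_interval topology normedtype trigo.

Set Implicit Arguments.
Unset Strict Implicit.
Unset Printing Implicit Defensive.

Import Order.TTheory GRing.Theory Num.Theory.

(** * Angles and points of the unit circle *)

Section Angles.
Variable R : realType.
Local Open Scope ring_scope.

(** The subtraction formula gives [cos (s - t) = 1], so half the difference is a zero of [sin] in
    [[0, pi)]. *)
Lemma circle_point_inj (s t : R) : `|s - t| < 2 * pi ->
  (cos s, sin s) = (cos t, sin t) -> s = t.
Proof.
wlog le_ts : s t / t <= s => [H lt e|].
  have [/H|/ltW/H] := leP t s; first exact.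
  by rewrite distrC => /(_ lt (esym e)) ->.
rewrite ger0_norm ?subr_ge0// => lt [ec es].
have [y sty] : exists y, s - t = y *+ 2 by exists ((s - t) / 2); lra.
have : cos (s - t) = 1 by rewrite cosB ec es -!expr2 cos2Dsin2.
rewrite sty cos_mulr2n cos2sin2 => cy.
have sy : sin y = 0 by apply/eqP; rewrite -sqrf_eq0; apply/eqP; lra.
have [y0|] := ltP 0 y; last by move=> ?; lra.
by have := @sin_gt0_pi R y; rewrite sy ltxx => /(_ ltac:(apply/andP; split; lra)).
Qed.

End Angles.

(** * Arc representations built from integer positions *)

Section ArcModel.
Variables (R : realType) (V : finType) (S : pred V) (w lo hi : V -> nat).

(* [u] in the class [S] sits at position [w u] on the circle; the other
   vertices are arcs running from [lo v] through the origin to [hi v]. *)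
Definition arc_adj : rel V := [rel u v |
  (u != v) &&
  match S u, S v with
  | true, true => false
  | true, false => (w u <= hi v) || (lo v <= w u)
  | false, true => (w v <= hi u) || (lo u <= w v)
  | false, false => true
  end].

Lemma arc_adj_sym : symmetric arc_adj.
Proof. by move=> u v; rewrite /arc_adj /= eq_sym; case: (S u); case: (S v). Qed.

Lemma arc_adj_irr : irreflexive arc_adj.
Proof. by move=> u; rewrite /arc_adj /= eqxx. Qed.

Definition arc_graph := SGraph arc_adj_sym arc_adj_irr.

Hypothesis w_inj : injective w.
Hypothesis w_gt0 : forall v, 0 < w v.
Hypothesis w_le : forall v, w v <= #|V|.
Hypothesis hilo : forall v, hi v < lo v.
Hypothesis lo_le : forall v, lo v <= #|V|.

Local Open Scope ring_scope.
Local Open Scope classical_set_scope.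

Lemma arc_graph_circular : circular_arc_graph R arc_graph.
Proof.
(* One slot for each position from 0 to [#|V|]. Slot 0 holds the origin and no class vertex, since
   [w] is positive; class arcs fill only the first half of their slots. *)
pose d : R := pi / #|V|.+1%:R.
have d0 : 0 < d by rewrite divr_gt0 ?pi_gt0.
have dN : 2 * pi = d *+ (2 * #|V|.+1).
  by rewrite mulnC mulrnA -[d *+ _]mulr_natr divfK ?pnatr_eq0// mulr_natl.
have lemul m n : (m <= n)%N -> d *+ m <= d *+ n by move=> ?; rewrite ler_pMn2l.
have ltmul m n : (m < n)%N -> d *+ m < d *+ n by move=> ?; rewrite ltr_pMn2l.
(* Slots of width [2 d]; arcs outside [S] start a full turn before [lo v], so
   that their angular interval contains [0]. *)
pose a v := if S v then d *+ (2 * w v) else d *+ (2 * lo v) - 2 * pi.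
pose b v := if S v then d *+ (2 * w v).+1 else d *+ (2 * hi v).+1.
pose arc v := [set (cos t, sin t) | t in `[a v, b v]].
have arcP t v : a v <= t <= b v -> arc v (cos t, sin t).
  by move=> h; exists t => //=; rewrite in_itv.
(* The two inequalities force [0 < s - t < 2 * pi] for all angles [s] of [u] and [t] of [v]. *)
have disj u v : b v < a u -> b u < a v + 2 * pi -> arc u `&` arc v !=set0 -> False.
  move=> vu uv [z [[s + <-]]]; rewrite /= in_itv /= => /andP[us su].
  move=> [t + /esym ts]; rewrite /= in_itv /= => /andP[vt tv].
  have/circle_point_inj/(_ ts) : `|s - t| < 2 * pi by rewrite ger0_norm; lra.
  lra.
exists arc; split=> [v|].
  exists (a v), (b v); split=> //; rewrite /a /b; case: (S v).
    have /ltmul := ltnSn (2 * w v).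
    have /ltmul : ((2 * w v).+1 < 2 * #|V|.+1 + 2 * w v)%N by lia.
    by rewrite [d *+ (2 * #|V|.+1 + _)]mulrnDr -dN; lra.
  have /ltmul : ((2 * hi v).+1 < 2 * lo v)%N by have := hilo v; lia.
  have /ltmul : (2 * lo v < 2 * #|V|.+1 + (2 * hi v).+1)%N by have := lo_le v; lia.
  by rewrite [d *+ (2 * #|V|.+1 + _)]mulrnDr -dN; lra.
have mixed u v : S u -> ~~ S v ->
    (w u <= hi v)%N || (lo v <= w u)%N <-> arc u `&` arc v !=set0.
  move=> Su /negbTE Sv; have := conj (w_le u) (lo_le v) => -[wu lov].
  split=> [/orP[whi|low]|uv].
  - exists (cos (d *+ (2 * w u)), sin (d *+ (2 * w u))); split; apply: arcP.
      by rewrite /a /b Su lexx lemul.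
    have /lemul : (2 * w u <= (2 * hi v).+1)%N by lia.
    have /lemul : (2 * lo v <= 2 * #|V|.+1 + 2 * w u)%N by lia.
    by rewrite /a /b Sv [d *+ (2 * #|V|.+1 + _)]mulrnDr -dN; lra.
  - exists (cos (d *+ (2 * w u)), sin (d *+ (2 * w u))); split; first apply: arcP.
      by rewrite /a /b Su lexx lemul.
    (* On the side of [lo v] the angle enters the interval of [v] only after a full turn is
       subtracted. *)
    have <- : cos (d *+ (2 * w u) - pi *+ 2) = cos (d *+ (2 * w u)).
      by rewrite -[LHS]cosD2pi subrK.
    have <- : sin (d *+ (2 * w u) - pi *+ 2) = sin (d *+ (2 * w u)).
      by rewrite -[LHS]sinD2pi subrK.
    apply: arcP; rewrite -[pi *+ 2]mulr_natl /a /b Sv.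
    have /lemul : (2 * lo v <= 2 * w u)%N by lia.
    have /lemul : (2 * w u <= 2 * #|V|.+1 + (2 * hi v).+1)%N by lia.
    by rewrite [d *+ (2 * #|V|.+1 + _)]mulrnDr -dN; lra.
  - rewrite leqNgt (leqNgt (lo v)) -negb_and; apply/negP => /andP[hw wl].
    apply: disj uv; rewrite /a /b Su Sv; first by apply: ltmul; lia.
    by rewrite subrK; apply: ltmul; lia.
have points u v : S u -> S v -> (w u < w v)%N -> arc v `&` arc u !=set0 -> False.
  move=> Su Sv uv; apply: disj; rewrite /a /b Su Sv; first by apply: ltmul; lia.
  by rewrite dN -mulrnDr; apply: ltmul; have := w_le v; lia.
move=> u v nuv; rewrite /= /arc_adj /= nuv /=.
case Su: (S u); case Sv: (S v).
- split=> // uv; have [lt|gt|/w_inj/eqP] := ltngtP (w u) (w v).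
  + by move: uv; rewrite setIC => /(points _ _ Su Sv lt).
  + by move: uv => /(points _ _ Sv Su gt).
  + by rewrite (negbTE nuv).
- by apply: mixed; rewrite ?Sv.
- by rewrite setIC; apply: mixed; rewrite ?Su.
- split=> // _; exists (cos 0, sin 0).
  by split; apply: arcP; rewrite /a /b ?Su ?Sv dN subr_le0 mulrn_wge0 ?(ltW d0)// andbT;
     apply: lemul; rewrite leq_mul2l /= ltnW// ltnS lo_le.
Qed.

End ArcModel.

(** * Ranks and greedy colouring *)

Section LinearOrder.
Variables (V : finType) (le : rel V).
Hypothesis le_lin : linear_order le.

(** Serves as the position on the circle; counting from 1 leaves 0 free for the origin. *)
Definition rank v := #|[pred u | le u v]|.

Lemma rank_le u v : le u v = (rank u <= rank v).
Proof.
have [r a t tot] := le_lin.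
have homo x y : le x y -> rank x <= rank y.
  by move=> xy; apply: subset_leq_card; apply/fintype.subsetP => z; rewrite !inE => /t; apply.
apply/idP/idP => [|uv]; first exact: homo.
apply: contraLR uv => /negbTE nuv; rewrite -ltnNge; apply: proper_card; apply/properP.
have vu : le v u by have := tot u v; rewrite nuv.
split; first by apply/fintype.subsetP => z; rewrite !inE => /t; apply.
by exists u; rewrite !inE ?r ?nuv.
Qed.

Lemma rank_inj : injective rank.
Proof.
have [_ a _ _] := le_lin => u v uv.
by apply: a; rewrite !rank_le uv leqnn.
Qed.

Lemma rank_gt0 v : 0 < rank v.
Proof. by have [r _ _ _] := le_lin; apply/card_gt0P; exists v; rewrite inE. Qed.

Lemma rank_max v : rank v <= #|V|.
Proof. exact: max_card. Qed.

End LinearOrder.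

(** All vertices with [w v = k] are coloured at once: [B] strictly lowers [w], so the vertices in
    [B v] already have colours, and these block fewer than [r] values. *)
Lemma greedy_coloring (V : finType) (w : V -> nat) (B : rel V) r :
    (forall v u, B v u -> w u < w v) -> (forall v, #|B v| < r) ->
  exists c : V -> nat, (forall v, c v < r) /\ forall v u, B v u -> c u != c v.
Proof.
move=> Bw Br.
suff /(_ (\max_v w v).+1)[c cP] : forall k, exists c : V -> nat, forall v,
    w v < k -> c v < r /\ forall u, B v u -> c u != c v.
  by exists c; split=> [v|v u]; have [] := cP v (leq_bigmax v) => // _; exact.
elim=> [|k [c cP]]; first by exists (fun=> 0).
have free v : exists i, (i < r) && (i \notin [seq c u | u in B v]).
  have /allPn[i] : ~~ all [in [seq c u | u in B v]] (iota 0 r).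
    apply: contraL (Br v) => /allP sub; rewrite -leqNgt.
    by have := uniq_leq_size (iota_uniq 0 r) sub; rewrite size_iota size_image.
  by rewrite mem_iota => ir ic; exists i; apply/andP.
exists (fun v => if w v == k then xchoose (free v) else c v) => v.
rewrite ltnS leq_eqVlt; case: eqVneq => [vk _|nvk /= wvk].
  have /andP[cr cn] := xchooseP (free v); split=> // u Bvu.
  rewrite -vk (ltn_eqF (Bw _ _ Bvu)).
  by apply: contraNneq cn => <-; apply: fintype.image_f.
have [cr cB] := cP v wvk; split=> // u Bvu.
by rewrite (ltn_eqF (ltn_trans (Bw _ _ Bvu) wvk)) cB.
Qed.

(** * Colouring along strong 2-reachability *)

Section StrongTwoColoring.
Variables (V : finType) (G : sgraph V) (le : rel V).
Hypothesis le_lin : linear_order le.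

Lemma adj_strongly_reachable u v : adj G u v -> le u v -> strongly_reachable G 2 le v u.
Proof.
have [r _ _ _] := le_lin => uv luv; exists [:: u]; split=> //=.
- by rewrite adj_sym uv.
- by rewrite inE andbT; apply: contraTneq uv => ->; rewrite adj_irr.
- by move=> x; rewrite !inE => /orP[] /eqP->; rewrite ?r ?eqxx ?luv; split.
Qed.

Lemma common_neighbor_strongly_reachable u v x : adj G u x -> adj G v x ->
  u != v -> le u v -> le v x -> strongly_reachable G 2 le v u.
Proof.
have [r _ t _] := le_lin => ux vx nuv luv lvx; exists [:: x; u].
have lux := t _ _ _ luv lvx; split=> //=.
- by rewrite vx adj_sym ux.
- rewrite !inE negb_or !andbT (eq_sym v u) nuv andbT.
  by apply/andP; split; [apply: contraTneq vx => -> | apply: contraTneq ux => ->];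
    rewrite adj_irr.
- by move=> y; rewrite !inE => /or3P[] /eqP->; rewrite ?r ?eqxx ?luv ?lux ?lvx; split.
Qed.

Lemma strong_coloring : exists c : V -> nat,
  (forall v, c v < max_strongly_reachable G 2 le) /\
  forall u v, u != v -> strongly_reachable G 2 le v u -> c u != c v.
Proof.
have [r _ _ _] := le_lin.
pose B : rel V := [rel v u | (u != v) && `[< strongly_reachable G 2 le v u >]].
have Ble v u : B v u -> rank le u < rank le v.
  move=> /andP[nuv /asboolP[p [_ _ _ _ /(_ v (mem_head _ _))[luv _]]]].
  rewrite ltn_neqAle -rank_le// luv andbT.
  by apply: contraNneq nuv => /(rank_inj le_lin) ->.
have [v|c [cr cB]] := greedy_coloring (r := max_strongly_reachable G 2 le) Ble.
  rewrite /max_strongly_reachable.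
  apply: leq_trans (leq_bigmax v).
  (* [v] reaches itself by the trivial path; discarding it gives the strict bound. *)
  rewrite [leqRHS](cardD1 v) inE asboolT ?add1n ?ltnS.
    by apply: subset_leq_card; apply/fintype.subsetP => u; rewrite !inE.
  by exists [::]; split=> // x; rewrite inE => /eqP->.
by exists c; split=> // u v nuv /asboolP vu; apply: cB; rewrite /B /= nuv.
Qed.

End StrongTwoColoring.

(** * The two graphs of a colour class *)

Section ColorClass.
Variables (V : finType) (G : sgraph V) (le : rel V).
Hypothesis le_lin : linear_order le.
Variable S : pred V.
Hypothesis S_stable : forall u v, S u -> S v -> ~~ adj G u v.
Hypothesis S_back : forall u v x, S u -> S v -> adj G u x -> adj G v x ->
  le u x -> le v x -> u = v.

Local Notation rk := (rank le).

(* The rank of the only possible neighbour of [v] in [S] before [v], or [0],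
   which is not a rank, if there is none. *)
Definition back v := \max_(u | [&& S u, adj G u v & le u v]) rk u.

(** By [S_back] the maximum runs over [u] alone. *)
Lemma back_adj u v : S u -> adj G u v -> le u v -> back v = rk u.
Proof.
move=> Su uv luv; rewrite /back (bigD1 u) /= ?Su ?uv// big1 ?maxn0// => x.
by move=> /andP[/and3P[Sx xv lxv]]; rewrite (S_back Sx Su xv uv lxv luv) eqxx.
Qed.

Lemma back_attained v : 0 < back v ->
  exists u, [/\ S u, adj G u v, le u v & back v = rk u].
Proof.
move=> b0; have [u P|none] := pickP [pred u | [&& S u, adj G u v & le u v]].
  by move/and3P: P => [Su uv luv]; exists u; split=> //; exact: back_adj.
by rewrite /back big_pred0 in b0.
Qed.

Lemma back_lt v : back v < rk v.
Proof.
have [->|/back_attained[u [_ uv luv ->]]] := posnP (back v); first exact: rank_gt0.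
rewrite ltn_neqAle -rank_le// luv andbT.
by apply: contraTneq uv => /(rank_inj le_lin) ->; rewrite adj_irr.
Qed.

(** If no earlier neighbour exists, starting the arc at 0 would meet the whole class; starting at
    [v] meets only its later members. *)
Definition back_lo v := if back v == 0 then rk v else back v.

Definition tail_graph := arc_graph S rk back_lo (fun=> 0).

Definition wrap_graph := arc_graph S rk rk back.

Lemma class_graph_circular (R : realType) (b : bool) :
  circular_arc_graph R (if b then tail_graph else wrap_graph).
Proof.
have rI := rank_inj le_lin; have r0 := rank_gt0 le_lin.
have bm v : back v <= #|V| by rewrite (leq_trans (ltnW (back_lt v)))// rank_max.
case: b; apply: arc_graph_circular => // v; rewrite ?rank_max ?back_lt//.
  by rewrite /back_lo; case: (posnP (back v)).
by rewrite /back_lo; case: ifP; rewrite ?rank_max.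
Qed.

(** A class neighbour of [y] either sits at [back y] or comes after [y], and both kinds of arc cover
    these positions. *)
Lemma class_graph_adj (b : bool) u v :
  adj G u v -> adj (if b then tail_graph else wrap_graph) u v.
Proof.
have [_ _ _ tot] := le_lin.
have hit x y : S x -> adj G x y -> (rk x = back y) \/ (rk y <= rk x).
  move=> Sx xy; have /orP[lxy|] := tot x y; last by rewrite rank_le//; right.
  by left; rewrite (back_adj Sx xy lxy).
move=> uv; have nuv : u != v by apply: contraTneq uv => ->; rewrite adj_irr.
have vu : adj G v u by rewrite adj_sym.
have u0 := rank_gt0 le_lin u; have v0 := rank_gt0 le_lin v.
have ub := back_lt u; have vb := back_lt v.
case: b; rewrite /= /arc_adj /= nuv /=; case Su: (S u); case Sv: (S v) => //.
- by rewrite (negbTE (S_stable Su Sv)) in uv.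
- by rewrite /back_lo; case: (posnP (back v)); case: (hit _ _ Su uv); lia.
- by rewrite /back_lo; case: (posnP (back u)); case: (hit _ _ Sv vu); lia.
- by rewrite (negbTE (S_stable Su Sv)) in uv.
- by case: (hit _ _ Su uv); lia.
- by case: (hit _ _ Sv vu); lia.
Qed.

(** For [v] outside [S] with an earlier class neighbour, [tail_graph] misses the positions before
    [back v], and [wrap_graph] those strictly between [back v] and [rk v]. *)
Lemma class_graph_nonadj u v : S u -> u != v -> le u v -> ~~ adj G u v ->
  exists b : bool, ~~ adj (if b then tail_graph else wrap_graph) u v.
Proof.
move=> Su nuv luv uv.
have u0 := rank_gt0 le_lin u.
have ruv : rk u < rk v.
  rewrite ltn_neqAle -rank_le// luv andbT.
  by apply: contraNneq nuv => /(rank_inj le_lin)->.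
case Sv: (S v); first by exists true; rewrite /= /arc_adj /= Su Sv andbF.
have [b0|bp] := posnP (back v).
  by exists true; rewrite /= /arc_adj /= Su Sv nuv /back_lo b0 /=; lia.
have [x [Sx xv lxv bE]] := back_attained bp.
have nb : rk u != back v.
  by rewrite bE; apply: contraNneq uv => /(rank_inj le_lin)->.
by exists (rk u < back v); case: ltnP => ub;
  rewrite /= /arc_adj /= Su Sv nuv /back_lo ?(gtn_eqF bp) /=; lia.
Qed.

End ColorClass.

(** * Assembling the graphs of all colours *)

Lemma circ_dim_le_strong_col (R : realType) (V : finType) (G : sgraph V) :
  circ_dim R G <= 2 * strong_col 2 G.
Proof.
rewrite /circ_dim; case: ex_minnP => k _; apply; apply/asboolP.
rewrite /strong_col; case: ex_minnP => r /asboolP[le le_lin rE] _.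
have [c [cr cP]] := strong_coloring G le_lin; rewrite rE in cr.
have [_ _ _ tot] := le_lin.
pose S i := [pred v | c v == i].
have stable i u v : S i u -> S i v -> ~~ adj G u v.
  move=> /eqP ui /eqP vi; apply/negP => uv.
  have nuv : u != v by apply: contraTneq uv => ->; rewrite adj_irr.
  wlog luv : u v ui vi uv nuv / le u v => [H|].
    by have /orP[/H|/H] := tot u v; apply; rewrite // 1?adj_sym// eq_sym.
  have := adj_strongly_reachable le_lin uv luv.
  by move/(cP _ _ nuv); rewrite ui vi eqxx.
have back_uniq i u v x : S i u -> S i v -> adj G u x -> adj G v x ->
    le u x -> le v x -> u = v.
  move=> /eqP ui /eqP vi; have [//|nuv] := eqVneq u v.
  wlog luv : u v ui vi nuv / le u v => [H ux vx lux lvx|ux vx lux lvx].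
    have /orP[luv|lvu] := tot u v; first exact: H.
    by apply/esym/H; rewrite // eq_sym.
  have := common_neighbor_strongly_reachable le_lin ux vx nuv luv lvx.
  by move/(cP _ _ nuv); rewrite ui vi eqxx.
(* The index encodes a pair: [i./2] is the colour and the parity selects the graph. *)
exists (fun i : 'I_(2 * r) => if odd i then tail_graph G le (S i./2)
                              else wrap_graph G le (S i./2)).
split=> [i|u v].
  exact: (class_graph_circular le_lin (@back_uniq i./2)).
rewrite /= /inter_adj /=; have [<-|nuv] /= := eqVneq u v; first by rewrite adj_irr.
apply/idP/forallP => [uv i|H].
  exact: (class_graph_adj le_lin (@stable i./2) (@back_uniq i./2)).
apply: contraT => uv.
(* The colour of the smaller end determines the class whose graphs separate the pair. *)
wlog luv : u v nuv H uv / le u v => [W|].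
  have /orP[/W|/W] := tot u v; apply=> //; rewrite 1?eq_sym 1?adj_sym//.
  by move=> i; rewrite adj_sym.
have [b] := class_graph_nonadj le_lin (@back_uniq (c u)) (eqxx _) nuv luv uv.
have lt : b + (c u).*2 < 2 * r by have := cr u; case: b; lia.
have := H (Ordinal lt); rewrite /= oddD odd_double addbF oddb half_bit_double.
by move=> ->.
Qed.

Theorem theorem8 (R : realType) (V : finType) (G : sgraph V) :
  circ_dim R G <= 3 * strong_col 2 G.
Proof.
by apply: leq_trans (circ_dim_le_strong_col R G) _; rewrite leq_mul2r orbT.
Qed.
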